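(* Let $Y \in V^n$ be a tuple of complex samples. If the group $G\subseteq \mathrm{GL}_{\mathbb{C}}(V)$ is closed under non-zero complex scalar multiples, then the supremum of the log-likelihood $\ell_Y$ over the model $\mathcal{M}_G$ equals $$-\inf_{\lambda \in \mathbb{R}_{>0}}\left(\frac{\lambda}{n}\left(\inf_{h \in G_{\mathrm{SL}}^{+}} \| h \cdot Y\|^2\right) - \dim(V)\log\lambda\right).$$ The MLEs given $Y$, if they exist, are the matrices $\lambda h^{*} h$, where $h$ minimizes $\|h\cdot Y\|$ under the action of $G_{\mathrm{SL}}^{+}$ on $V^n$, and $\lambda \in \mathbb{R}_{>0}$ is the unique value minimizing the outer infimum.
   Context: $V$ is a finite-dimensional complex vector space, identified with $\mathbb{C}^m$, $m=\dim_{\mathbb{C}} V$, by a fixed isomorphism, so that elements of $\mathrm{GL}_{\mathbb{C}}(V)$ are invertible complex $m\times m$ matrices. $G\subseteq \mathrm{GL}_{\mathbb{C}}(V)$ is a subgroup; it is closed under non-zero complex scalar multiples if $cg\in G$ for all $g \in G$, $c\in\mathbb{C}\setminus\{0\}$. $G_{\mathrm{SL}}^{+}$ is the subgroup of all matrices in $G$ with determinant one. $g^*$ denotes the Hermitian (conjugate) transpose. The complex Gaussian group model given by $G$ is the set of concentration matrices $\mathcal{M}_G=\{g^{*}g \mid g\in G\}$. For $Y=(Y_1,\dots,Y_n)\in V^n$, the log-likelihood is $\ell_Y(\Psi)=\log\det(\Psi)-\mathrm{tr}(\Psi S_Y)$ for $\Psi\in\mathcal{M}_G$, where $S_Y=\frac1n\sum_{i=1}^n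 Y_iY_i^{*}$. An MLE given $Y$ is a matrix in $\mathcal{M}_G$ at which $\ell_Y$ attains its maximum over $\mathcal{M}_G$. The group $G$ acts on $V^n$ by $g\cdot Y=(gY_1,\dots,gY_n)$, and $\|g\cdot Y\|^2=\sum_{i=1}^n (gY_i)^*gY_i$. *)

(* Defs.v *)
From HB Require Import structures.
From mathcomp Require Import all_boot all_order all_algebra.
From mathcomp Require Import complex.
From mathcomp Require Import all_classical all_reals all_analysis.

Set Implicit Arguments.
Unset Strict Implicit.
Unset Printing Implicit Defensive.

Import Order.TTheory GRing.Theory Num.Theory.

Local Open Scope classical_set_scope.
Local Open Scope ring_scope.
Local Open Scope complex_scope.
Local Open Scope sesquilinear_scope.

Section GaussianGroupModel.
Variable R : realType.
Local Notation C := R[i].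

(* The matrix group is possibly infinite, and square matrices of size m form
   a ring with units in MathComp only when m is a successor; hence the
   explicit closure conditions, with [unitmx] and [invmx]. *)
Record is_GL_subgroup (m : nat) (G : set 'M[C]_m) : Prop := IsGLSubgroup {
  GL_subgroup_unit : forall g, G g -> g \in unitmx;
  GL_subgroup1 : G 1%:M;
  GL_subgroupM : forall g h, G g -> G h -> G (g *m h);
  GL_subgroupV : forall g, G g -> G (invmx g)
}.

Definition scalar_closed (m : nat) (G : set 'M[C]_m) : Prop :=
  forall (c : C) (g : 'M[C]_m), c != 0 -> G g -> G (c *: g).

Definition SL_part (m : nat) (G : set 'M[C]_m) : set 'M[C]_m :=
  [set g | G g /\ \det g = 1].

Definition group_model (m : nat) (G : set 'M[C]_m) : set 'M[C]_m :=
  [set g ^t* *m g | g in G].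

Definition group_act (m n : nat) (g : 'M[C]_m) (Y : 'I_n -> 'cV[C]_m) :
  'I_n -> 'cV[C]_m := fun i => g *m Y i.

(* [(Y i)^t* *m Y i] is a 1 x 1 matrix whose entry is a nonnegative real. *)
Definition tuple_norm (m n : nat) (Y : 'I_n -> 'cV[C]_m) : R :=
  Num.sqrt (\sum_(i < n) complex.Re (((Y i) ^t* *m Y i) 0 0)).

Definition sample_cov (m n : nat) (Y : 'I_n -> 'cV[C]_m) : 'M[C]_m :=
  n%:R^-1 *: \sum_(i < n) (Y i *m (Y i) ^t*).

(* When [Psi] is in [group_model G], with [G] a group of invertible matrices,
   it is Hermitian positive definite, so its determinant is a positive real and
   the trace is real: both occurrences of [complex.Re] only convert types. *)
Definition loglik (m n : nat) (Y : 'I_n -> 'cV[C]_m) (Psi : 'M[C]_m) : R :=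
  ln (complex.Re (\det Psi)) - complex.Re (\tr (Psi *m sample_cov Y)).

Definition is_MLE (m n : nat) (G : set 'M[C]_m) (Y : 'I_n -> 'cV[C]_m)
    (Psi : 'M[C]_m) : Prop :=
  group_model G Psi /\
  forall Phi, group_model G Phi -> loglik Y Phi <= loglik Y Psi.

Definition minimizes_norm (m n : nat) (H : set 'M[C]_m) (Y : 'I_n -> 'cV[C]_m)
    (h : 'M[C]_m) : Prop :=
  H h /\ forall h', H h' ->
    tuple_norm (group_act h Y) <= tuple_norm (group_act h' Y).

Definition outer_objective (m n : nat) (G : set 'M[C]_m)
    (Y : 'I_n -> 'cV[C]_m) (lam : R) : \bar R :=
  ((lam / n%:R)%:E
     * ereal_inf [set (tuple_norm (group_act h Y) ^+ 2)%:E | h in SL_part G]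
   - (m%:R * ln lam)%:E)%E.

Definition minimizes_outer (m n : nat) (G : set 'M[C]_m)
    (Y : 'I_n -> 'cV[C]_m) (lam : R) : Prop :=
  0 < lam /\ forall mu : R, 0 < mu ->
    (outer_objective G Y lam <= outer_objective G Y mu)%E.

End GaussianGroupModel.

(* Main.v *)
Require Import Defs.
From HB Require Import structures.
From mathcomp Require Import all_boot all_order all_algebra.
From mathcomp Require Import complex.
From mathcomp Require Import all_classical all_reals all_analysis.
From mathcomp Require Import ring lra.

(** Extracting an [m]-th root of the determinant and using closure under
    scalars, every element of the model is [lam * h^* h] with [lam > 0] and
    [h] in the determinant-one part, and conversely.  There the log-likelihood
    is [m ln lam - (lam / n) |h Y|^2], so maximizing over [h] for fixed [lam]
    means minimizing [|h Y|^2].  The outer minimizer is unique because [ln] is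
    strictly concave. *)

Set Implicit Arguments.
Unset Strict Implicit.
Unset Printing Implicit Defensive.

Import Order.TTheory GRing.Theory Num.Theory.

Local Open Scope classical_set_scope.
Local Open Scope ring_scope.
Local Open Scope complex_scope.
Local Open Scope sesquilinear_scope.

Lemma conj_realC (R : rcfType) (x : R) : Num.conj (x%:C : R[i]) = x%:C.
Proof. by apply/CrealP; rewrite complex_real. Qed.

Lemma adjoint_mulmx (R : rcfType) (m n p : nat) (A : 'M[R[i]]_(m, n))
    (B : 'M[R[i]]_(n, p)) : (A *m B) ^t* = B ^t* *m A ^t*.
Proof. by rewrite trmx_mul map_mxM. Qed.

Lemma adjoint_scale_mul (R : rcfType) (m : nat) (c : R[i]) (g : 'M[R[i]]_m) :
  (c *: g) ^t* *m (c *: g) = `|c| ^+ 2 *: (g ^t* *m g).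
Proof.
by rewrite [(c *: g)^T]linearZ /= map_mxZ -scalemxAl -scalemxAr scalerA normCK mulrC.
Qed.

(** Moves [|c| ^+ 2] from [R[i]] to [R], so that it can serve as the scale [lam] of a model
    element. *)
Lemma normC_sqr_real (R : rcfType) (c : R[i]) : c != 0 ->
  exists2 x : R, 0 < x & `|c| ^+ 2 = x%:C.
Proof.
move=> c0; rewrite -add_Re2_Im2.
exists (complex.Re c ^+ 2 + complex.Im c ^+ 2) => //.
by rewrite -ltcR add_Re2_Im2 exprn_gt0 // normr_gt0.
Qed.

Lemma Re_adjoint_mul_ge0 (R : realType) (m : nat) (v : 'cV[R[i]]_m) :
  0 <= complex.Re ((v ^t* *m v) 0 0).
Proof.
suff : 0 <= (v ^t* *m v) 0 0 by rewrite lecE => /andP[].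
rewrite mxE; apply: sumr_ge0 => i _.
by rewrite !mxE mulrC mul_conjC_ge0.
Qed.

Lemma tuple_norm_sqr (R : realType) (m n : nat) (Y : 'I_n -> 'cV[R[i]]_m) :
  tuple_norm Y ^+ 2 = \sum_(i < n) complex.Re (((Y i) ^t* *m Y i) 0 0).
Proof. by rewrite sqr_sqrtr // sumr_ge0 // => i _; exact: Re_adjoint_mul_ge0. Qed.

Lemma trace_adjoint_mul_sample_cov (R : realType) (m n : nat)
    (Y : 'I_n -> 'cV[R[i]]_m) (g : 'M[R[i]]_m) :
  complex.Re (\tr (g ^t* *m g *m sample_cov Y))
    = n%:R^-1 * tuple_norm (group_act g Y) ^+ 2.
Proof.
rewrite tuple_norm_sqr /sample_cov -scalemxAr mxtraceZ.
have -> : n%:R^-1 = (n%:R^-1)%:C :> R[i] by rewrite fmorphV rmorph_nat.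
rewrite mulmx_sumr raddf_sum /=.
have ReZ (x : R) (z : R[i]) : complex.Re (x%:C * z) = x * complex.Re z.
  by case: z => a b /=; rewrite mul0r subr0.
rewrite ReZ raddf_sum; congr (_ * _); apply: eq_bigr => i _.
rewrite /group_act -trace_mx11 adjoint_mulmx mulmxA mxtrace_mulC.
by rewrite !mulmxA.
Qed.

Lemma loglik_scale (R : realType) (m n : nat) (Y : 'I_n -> 'cV[R[i]]_m)
    (lam : R) (h : 'M[R[i]]_m) : 0 < lam -> \det h = 1 ->
  loglik Y (lam%:C *: (h ^t* *m h))
    = m%:R * ln lam - lam / n%:R * tuple_norm (group_act h Y) ^+ 2.
Proof.
move=> lam0 h1; rewrite /loglik; congr (_ - _).
  rewrite detZ det_mulmx det_map_mx det_tr h1 rmorph1 !mulr1 -rmorphXn /=.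
  by rewrite lnXn // mulr_natl.
rewrite -scalemxAl mxtraceZ -mulrA -trace_adjoint_mul_sample_cov.
by case: (\tr _) => a b /=; rewrite mul0r subr0.
Qed.

Lemma group_model_polar (R : realType) (m : nat) (G : set 'M[R[i]]_m)
    (Psi : 'M[R[i]]_m) : is_GL_subgroup G -> scalar_closed G ->
  group_model G Psi <->
  exists (lam : R) (h : 'M[R[i]]_m),
    [/\ 0 < lam, SL_part G h & Psi = lam%:C *: (h ^t* *m h)].
Proof.
move=> GG Gs; split=> [[g Gg <-]|[lam [h [lam0 [Gh _] ->]]]]; last first.
  (* The factor [lam] is absorbed into the group element as the scalar sqrt(lam), whose squared
     modulus is [lam]. *)
  have s0 : (Num.sqrt lam)%:C != 0 :> R[i].
    by rewrite fmorph_eq0 gt_eqF // sqrtr_gt0.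
  exists ((Num.sqrt lam)%:C *: h); first exact: Gs.
  rewrite adjoint_scale_mul normCK conj_realC -rmorphM -expr2.
  by rewrite sqr_sqrtr // ltW.
(* In dimension 0 there is no m-th root to take, but the empty determinant is already 1, so [g]
   itself works with scale 1. *)
have [m0|m_gt0] := posnP m.
  exists 1, g; split=> //; last by rewrite scale1r.
  by split=> //; move: g {Gg}; rewrite m0 => g; rewrite det_mx00.
have dg0 : \det g != 0.
  by have := GL_subgroup_unit GG Gg; rewrite unitmxE unitfE.
(* Any complex m-th root will do: g / c has determinant 1, and only |c|^2 survives in g^* g. *)
set c := (nthroot m (\det g) : R[i]).
have cm : c ^+ m = \det g by rewrite rootCK.
have c0 : c != 0.
  by apply: contra_neq dg0 => c0; rewrite -cm c0 expr0n gtn_eqF.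
have [lam lam0 lamE] := normC_sqr_real c0.
exists lam, (c^-1 *: g); split=> //.
  split; first by apply: Gs => //; rewrite invr_eq0.
  by rewrite detZ exprVn cm mulVf.
by rewrite -lamE -adjoint_scale_mul scalerA divff // scale1r.
Qed.

Section InnerInfimum.
Variables (R : realType) (m n : nat) (G : set 'M[R[i]]_m).
Variable Y : 'I_n -> 'cV[R[i]]_m.
Hypothesis GG : is_GL_subgroup G.

Let norms := [set tuple_norm (group_act h Y) ^+ 2 | h in SL_part G].

Let norms_has_inf : has_inf norms.
Proof.
split; last by exists 0 => _ [h _ <-]; exact: sqr_ge0.
exists (tuple_norm (group_act 1%:M Y) ^+ 2), 1%:M => //.
by split; [exact: GL_subgroup1 | exact: det1].
Qed.

Lemma inf_norm_le h : SL_part G h -> inf norms <= tuple_norm (group_act h Y) ^+ 2.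
Proof. by move=> Gh; apply: ge_inf; [case: norms_has_inf | exists h]. Qed.

Lemma le_inf_norm c :
  (forall h, SL_part G h -> c <= tuple_norm (group_act h Y) ^+ 2) ->
  c <= inf norms.
Proof.
by move=> cP; apply: lb_le_inf; [case: norms_has_inf | move=> _ [h /cP ? <-]].
Qed.

Lemma inf_normE h : minimizes_norm (SL_part G) Y h ->
  inf norms = tuple_norm (group_act h Y) ^+ 2.
Proof.
move=> [Gh hmin]; apply/eqP; rewrite eq_le inf_norm_le //=.
by apply: le_inf_norm => h' /hmin; rewrite ler_sqr ?nnegrE ?sqrtr_ge0.
Qed.

(** The squared norms are bounded below by 0 and include the value at the identity, so their
    extended infimum is finite. The later arguments can then be carried out in [R]. *)
Lemma outer_objectiveE lam :
  outer_objective G Y lam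
    = (lam / n%:R * inf norms - m%:R * ln lam)%:E.
Proof.
rewrite /outer_objective.
have [norms0 norms_lb] := norms_has_inf.
by rewrite -(image_comp (fun h => tuple_norm (group_act h Y) ^+ 2) EFin)
  ereal_inf_EFin.
Qed.

End InnerInfimum.

(** Strict midpoint concavity of [ln]: after exponentiating it is the strict AM-GM inequality xy <
    ((x + y) / 2)^2, that is, (x - y)^2 > 0. *)
Lemma ln_midpoint_gt (R : realType) (x y : R) : 0 < x -> 0 < y -> x != y ->
  ln x + ln y < 2 * ln ((x + y) / 2).
Proof.
move=> x0 y0 xy.
have z0 : 0 < (x + y) / 2 by rewrite divr_gt0 // addr_gt0.
rewrite mulr_natl -lnXn // -lnM // ltr_ln ?posrE ?exprn_gt0 //; last exact: mulr_gt0.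
have : 0 < (x - y) ^+ 2 by rewrite exprn_even_gt0 //= subr_eq0.
by nra.
Qed.

Theorem proposition3p13 (R : realType) (m n : nat) (G : set 'M[R[i]]_m)
    (Y : 'I_n -> 'cV[R[i]]_m) (n_gt0 : (0 < n)%N)
    (G_group : is_GL_subgroup G) (G_scalar : scalar_closed G) :
  [/\ ereal_sup [set (loglik Y Psi)%:E | Psi in group_model G]
        = (- ereal_inf [set outer_objective G Y lam | lam in [set l : R | (0 < l)%R]])%E,
      forall Psi : 'M[R[i]]_m,
        is_MLE G Y Psi <->
        exists (h : 'M[R[i]]_m) (lam : R),
          [/\ minimizes_norm (SL_part G) Y h,
              minimizes_outer G Y lam
            & Psi = lam%:C *: (h ^t* *m h)]
    & (0 < m)%N -> (exists Psi : 'M[R[i]]_m, is_MLE G Y Psi) ->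
        exists! lam : R, minimizes_outer G Y lam].
Proof.
have polar Psi := group_model_polar Psi G_group G_scalar.
have modelP lam h : 0 < lam -> SL_part G h ->
    group_model G (lam%:C *: (h ^t* *m h)).
  by move=> lam0 Gh; apply/polar; exists lam, h.
have n0 : 0 < n%:R :> R by rewrite ltr0n.
have loglikE lam h : 0 < lam -> SL_part G h ->
    loglik Y (lam%:C *: (h ^t* *m h))
      = m%:R * ln lam - lam / n%:R * tuple_norm (group_act h Y) ^+ 2.
  by move=> lam0 [_ h1]; exact: loglik_scale.
have loglik_le lam h : 0 < lam -> SL_part G h ->
    ((loglik Y (lam%:C *: (h ^t* *m h)))%:E <= - outer_objective G Y lam)%E.
  move=> lam0 Gh; rewrite outer_objectiveE // loglikE //.
  rewrite -EFinN lee_fin opprB lerD2l lerN2 ler_wpM2l ?inf_norm_le //.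
  by rewrite divr_ge0 // ltW.
have MLE_minimizes Psi : is_MLE G Y Psi -> exists (h : 'M[R[i]]_m) (lam : R),
    [/\ minimizes_norm (SL_part G) Y h, minimizes_outer G Y lam
      & Psi = lam%:C *: (h ^t* *m h)].
  move=> [/polar[lam [h [lam0 Gh ->]]] Psi_max].
  (* Compare [Psi] with competitors of the same scale [lam]; below, with competitors sharing the
     same [h]. *)
  have hmin : minimizes_norm (SL_part G) Y h.
    split=> // h' Gh'; have := Psi_max _ (modelP _ _ lam0 Gh').
    rewrite !loglikE //.
    rewrite lerD2l lerN2 ler_pM2l ?divr_gt0 //.
    by rewrite ler_sqr ?nnegrE ?sqrtr_ge0.
  exists h, lam; split=> //; split=> // mu mu0.
  have := Psi_max _ (modelP _ _ mu0 Gh).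
  rewrite !loglikE //.
  (* As [h] attains the inner infimum, the outer objective at each scale is minus the log-likelihood
     along the ray through h^* h. *)
  by rewrite !outer_objectiveE // !(inf_normE G_group hmin) lee_fin; lra.
split.
- apply/eqP; rewrite eq_le; apply/andP; split.
    apply: ge_ereal_sup => _ [Psi /polar[lam [h [lam0 Gh ->]]] <-].
    apply: le_trans (loglik_le _ _ lam0 Gh) _.
    by rewrite leeN2; apply: ereal_inf_lbound; exists lam.
  (* For the reverse inequality it suffices that minus the supremum is below the outer objective at
     each fixed [lam]. *)
  rewrite leeNl; apply: le_ereal_inf_tmp => _ [lam lam0 <-].
  set s := ereal_sup _.
  have le_s h : SL_part G h ->
      ((m%:R * ln lam - lam / n%:R * tuple_norm (group_act h Y) ^+ 2)%:E <= s)%E.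
    move=> Gh; rewrite -loglikE //.
    by apply: ereal_sup_ubound; exists (lam%:C *: (h ^t* *m h)) => //; exact: modelP.
  have G1 : SL_part G 1%:M by split; [exact: GL_subgroup1 | exact: det1].
  (* The identity matrix excludes a supremum of -oo, and +oo makes the bound trivial. *)
  rewrite outer_objectiveE //; case: s le_s => [s| |] le_s; last first.
  + by have := le_s _ G1.
  + by rewrite leNye.
  rewrite -EFinN lee_fin.
  have k0 : 0 < lam / n%:R by rewrite divr_gt0.
  (* Isolating the infimum reduces the bound to one for each [h], which is [le_s]. *)
  rewrite lerBrDr [_ * inf _]mulrC -ler_pdivrMr //; apply: le_inf_norm => // h Gh.
  rewrite ler_pdivrMr // mulrC; have := le_s _ Gh; rewrite lee_fin; lra.
- move=> Psi; split; first exact: MLE_minimizes.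
  move=> [h [lam [hmin [lam0 lmin] ->]]]; have [Gh _] := hmin.
  split; first exact: modelP.
  (* The log-likelihood of the competitor is at most minus the objective at [mu], hence at most
     minus the objective at [lam], which is the log-likelihood at [lam] and [h]. *)
  move=> _ /polar[mu [h' [mu0 Gh' ->]]]; rewrite -lee_fin.
  apply: le_trans (loglik_le _ _ mu0 Gh') _.
  rewrite loglikE //.
  move: (lmin _ mu0); rewrite -leeN2 => /le_trans; apply.
  by rewrite !outer_objectiveE // (inf_normE G_group hmin) -EFinN opprB.
move=> m_gt0 [Psi /MLE_minimizes[_ [lam [_ lmin _]]]].
exists lam; split=> // mu [mu0 mumin]; have [lam0 lamP] := lmin.
apply/eqP/negPn/negP => lam_mu.
(* At the midpoint of two distinct minimizers the linear term is the average of its two values,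
   while -m ln is strictly below its average because m > 0. The objective would then drop below the
   minimum. For m = 0 it is constant and uniqueness fails. *)
have z0 : 0 < (lam + mu) / 2 by rewrite divr_gt0 // addr_gt0.
have := lamP _ z0; have := mumin _ z0.
rewrite !outer_objectiveE // !lee_fin.
have m0 : 0 < m%:R :> R by rewrite ltr0n.
have := ln_midpoint_gt lam0 mu0 lam_mu; rewrite -(ltr_pM2l m0).
set a := inf _; set L := ln _; set M := ln _; set Z := ln _.
rewrite mulrDr.
have -> : (lam + mu) / 2 / n%:R * a = (lam / n%:R * a + mu / n%:R * a) / 2.
  by field; rewrite gt_eqF.
lra.
Qed.
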